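(* There exist absolute constants $C>c>0$ such that the following holds. Let $H$ be an $n$-vertex $d$-regular graph. (1) If $\chi(H)=2$, then $n^{cd}\le ER(H)\le n^{Cd}$. (2) If $\chi:=\chi(H)\ge 3$, then $2^{cn}\le ER(H)\le n^{Cd\chi n}$.
   Context: Edge-colorings of the complete graph $K_N$ may use an arbitrary number of colors. A copy of a graph $H$ in $K_N$ is given by an injective map $\varphi:V(H)\to V(K_N)$, its edges being $\varphi(u)\varphi(v)$ for $uv\in E(H)$. The copy is canonically colored if it is (a) monochromatic (all its edges have the same color), (b) rainbow (all its edges have distinct colors), or (c) lexicographic: there is an ordering $v_1,\dots,v_n$ of $V(H)$ such that for every $i$, all edges $\varphi(v_i)\varphi(v_j)$ with $v_iv_j\in E(H)$ and $j>i$ have the same color $c_i$, and these colors are distinct for different vertices $v_i$. The Erdős–Rado number $ER(H)$ is the smallest $N$ such that every edge-coloring of $K_N$ contains a canonically colored copy of $H$. $\chi(H)$ denotes the chromatic number. *)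

(* Defs.v *)
From HB Require Import structures.
From mathcomp Require Import all_boot all_order all_algebra.
From mathcomp Require Import all_classical all_reals all_analysis.

Set Implicit Arguments.
Unset Strict Implicit.
Unset Printing Implicit Defensive.

Record sgraph := SGraph {
  vertex :> finType;
  adj : rel vertex;
  adj_sym : symmetric adj;
  adj_irrefl : irreflexive adj }.

Definition edges (H : sgraph) : {set {set H}} :=
  [set [set uv.1; uv.2] | uv : H * H & adj uv.1 uv.2].

Definition regular (H : sgraph) (d : nat) : Prop :=
  forall v : H, #|[set w | adj v w]| = d.

Definition colorable (H : sgraph) (k : nat) : bool :=
  [exists f : {ffun H -> 'I_k}, [forall u, forall v, adj u v ==> (f u != f v)]].

Lemma colorable_exists (H : sgraph) : exists k, colorable H k.
Proof.
exists #|H|; apply/existsP; exists [ffun u => enum_rank u].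
apply/forallP => u; apply/forallP => v; apply/implyP => uv.
rewrite !ffunE (inj_eq enum_rank_inj).
by apply: contraTneq uv => ->; rewrite adj_irrefl.
Qed.

Definition chromatic_number (H : sgraph) : nat := ex_minn (colorable_exists H).

(* An edge-coloring of K_N assigns the color col [set x; y] to the edge xy;
   the values of col on sets that are not pairs are never used.  Taking colors
   in nat does not bound the number of colors. *)
Definition coloring (N : nat) := {set 'I_N} -> nat.

Section Copies.
Variables (H : sgraph) (N : nat) (col : coloring N) (phi : H -> 'I_N).

Definition monochromatic : Prop :=
  {in edges H &, forall e e' : {set H}, col (phi @: e) = col (phi @: e')}.

Definition rainbow : Prop :=
  {in edges H &, injective (fun e : {set H} => col (phi @: e))}.

(* If v i has no neighbor later in the ordering, then c i is unconstrained,
   and it can be taken outside the finite range of the other colors. *)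
Definition lexicographic : Prop :=
  exists (v : 'I_#|H| -> H) (c : 'I_#|H| -> nat),
    [/\ bijective v, injective c &
        forall i j : 'I_#|H|, (i < j)%N -> adj (v i) (v j) ->
          col (phi @: [set v i; v j]) = c i].

Definition canonically_colored : Prop :=
  [\/ monochromatic, rainbow | lexicographic].

End Copies.

Definition canonical_ramsey (H : sgraph) (N : nat) : Prop :=
  forall col : coloring N,
    exists phi : H -> 'I_N, injective phi /\ canonically_colored col phi.

(* The Erdos-Rado number; the value 0 stands for "no such N", which a positive
   lower bound on ER H therefore excludes. *)
Definition ER (H : sgraph) : nat :=
  if pselect (exists N, `[< canonical_ramsey H N >]) is left exN
  then ex_minn exN else 0%N.

(* Main.v *)
(** Lower bounds.  For bipartite [H], colour the complete graph on [n ^ (d / 4)]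
    vertices at random with [n] colours: [H] has more than [n] edges, so no copy
    is rainbow, and a union bound over the copy, the vertex ordering and the
    colours [c_i] (monochromatic copies being the case of constant [c]) excludes
    the other two types.  For [chi >= 3], colour a pair of binary strings of
    length [(n-1)/2] by a coordinate in which they differ: the colour classes are
    bipartite, and both a rainbow and a lexicographic copy would need at least
    [n / 2] colours, because in a regular graph every independent set has at most
    half of the vertices.

    Upper bounds.  If almost all vertices of a large set [S] have every colour
    degree at most [#|S| / q], then a random [n]-tuple in [S] is rainbow.  For
    bipartite [H] one may thus assume that many vertices [v] have a popular
    colour [c v].  Dependent random choice in the digraph [v -> w] iff
    [col vw = c v] yields a large [U] in which any [d] vertices have [n] common
    out-neighbours; keeping [n] vertices of [U] on which [c] is constant or
    injective gives a monochromatic or a lexicographic copy.  In general, one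
    builds [S_0 > S_1 > ... > S_(n chi)] with colours [c_i], where any [d] vertices
    of [S_(i+1)] have [n] common [c_i]-neighbours in [S_i] (dependent random choice
    in a dense colour) unless [c_i] is new, in which case one common neighbour
    is enough.  Either [n] distinct colours occur, and there is a lexicographic
    copy with one vertex per step, or some colour occurs [chi + 1] times, and the
    [chi] steps after its first occurrence host the [chi] colour classes of a
    monochromatic copy. *)

Require Import Defs.
From mathcomp Require Import all_boot zify.

Set Implicit Arguments.
Unset Strict Implicit.
Unset Printing Implicit Defensive.

(** * Pigeonhole and greedy embedding *)

(** Induction on [n]: if the colour class of the first element has at most [m] elements, it is
    removed, and that element is put in front of an injective sequence found in the rest. A
    subsequence is produced rather than a set, so that the order of [s] survives. *)
Lemma pigeonhole_subseq (A : eqType) (c : A -> nat) (m n : nat) (s : seq A) :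
  uniq s -> n * m < size s ->
  exists2 t, subseq t s &
    (n < size t /\ {in t &, injective c}) \/
    (m < size t /\ exists a, {in t, forall x, c x = a}).
Proof.
elim: n s => [|n IHn] s s_uniq lt_s.
  case: s lt_s {s_uniq} => [|x s] //= _; exists [:: x]; first by rewrite eqxx sub0seq.
  by left; split=> // y z; rewrite !inE => /eqP-> /eqP->.
case: s s_uniq lt_s => [|x s] // s_uniq lt_s.
pose cls := [seq y <- x :: s | c y == c x].
have [lt_m|le_m] := ltnP m (size cls).
  exists cls; first exact: filter_subseq.
  right; split=> //; exists (c x) => y.
  by rewrite mem_filter => /andP[/eqP].
pose rest := [seq y <- s | c y != c x].
have rest_uniq : uniq rest by rewrite filter_uniq //; case/andP: s_uniq.
have lt_rest : n * m < size rest.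
  have: size cls + size rest = (size s).+1.
    rewrite /cls /rest /= eqxx /= !size_filter addSn; congr _.+1.
    by rewrite -(count_predC (fun y => c y == c x)).
  by move: lt_s le_m; rewrite /= mulSn; lia.
have [t t_rest t_ok] := IHn _ rest_uniq lt_rest.
have t_s : subseq t s := subseq_trans t_rest (filter_subseq _ _).
have cN y : y \in t -> c y <> c x.
  by move=> /(mem_subseq t_rest); rewrite mem_filter => /andP[/eqP].
case: t_ok => [[lt_t inj_t]|const_t].
  exists (x :: t); first by rewrite /= eqxx.
  left; split=> // y z; rewrite !inE => /predU1P[->|ty] /predU1P[->|tz] //.
  - by move=> /esym/cN; case/(_ tz).
  - by move/cN; case/(_ ty).
  - exact: inj_t.
exists t; first by rewrite (subseq_trans t_s) // subseq_cons.
by right.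
Qed.

Section Greedy.

Variables (H : sgraph) (T : finType) (d : nat) (r : H -> nat).
Variables (X Y Z : H -> {set T}) (E : H -> rel T).
Hypothesis deg_le : forall v : H, #|[set w | adj v w]| <= d.
Hypothesis XZ : forall u w, u != w -> r u <= r w -> X w \subset Z u.
Hypothesis XY : forall u w, adj u w -> r u <= r w -> X w \subset Y u.

(* Vertices are placed in order of decreasing rank.  [X u] is where [u] may go,
   [Y u] contains its neighbours placed before it, [Z u] all the vertices placed
   before it. *)
Lemma greedy_embedding :
  (forall u (W Q : {set T}), W \subset Z u -> #|W| < #|H| ->
     Q \subset W -> Q \subset Y u -> #|Q| <= d ->
     exists x, [/\ x \in X u, x \notin W & {in Q, forall y, E u x y}]) ->
  exists phi : H -> T, [/\ injective phi, forall u, phi u \in X u &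
    forall u w, adj u w -> r u < r w -> E u (phi u) (phi w)].
Proof.
move=> extend.
pose le_r : rel H := relpre r leq.
have [t0|H0] := posnP #|H|.
  have noH (u : H) : False by move/card0_eq/(_ u): t0; rewrite inE.
  by exists (fun u => False_rect T (noH u)); split=> u; case: (noH u).
have /card_gt0P[u0 _] := H0.
have [x0 _] : exists x, x \in X u0.
  have [x [xX _ _]] := extend u0 set0 set0 (sub0set _) ltac:(by rewrite cards0)
    (sub0set _) (sub0set _) ltac:(by rewrite cards0).
  by exists x.
(* Induction on the list sorted by increasing rank: its head has least rank and is placed after the
   whole tail. *)
suff [phi [inj_phi phiX phiE]] : exists phi : H -> T,
    [/\ {in sort le_r (enum H) &, injective phi},
        {in sort le_r (enum H), forall u, phi u \in X u} &
        {in sort le_r (enum H) &, forall u w, adj u w -> r u < r w ->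
           E u (phi u) (phi w)}].
  have inS u : u \in sort le_r (enum H) by rewrite mem_sort mem_enum.
  by exists phi; split=> [u w|u|u w]; [apply: inj_phi|apply: phiX|apply: phiE].
have: uniq (sort le_r (enum H)) by rewrite sort_uniq enum_uniq.
have: sorted le_r (sort le_r (enum H)).
  by apply: sort_sorted => u w; apply: leq_total.
elim: (sort _ _) => [|u s IHs] /=; first by exists (fun=> x0); split.
have le_r_tr : transitive le_r by move=> y x z; apply: leq_trans.
rewrite (path_sortedE le_r_tr) => /andP[/allP ule s_sorted] /andP[us s_uniq].
have [phi [inj_phi phiX phiE]] := IHs s_sorted s_uniq.
pose W := [set phi w | w in s]; pose Q := [set phi w | w in [pred w in s | adj u w]].
have [|||||x [xX xW xE]] := extend u W Q.
- apply/subsetP => _ /imsetP[w ws ->].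
  apply: (subsetP (XZ _ (ule w ws))); last exact: phiX.
  by apply: contraNneq us => ->.
- apply: (leq_ltn_trans (leq_imset_card _ _)); rewrite (card_uniqP s_uniq).
  have: uniq (u :: s) by rewrite /= us.
  by move/card_uniqP => /= <-; apply: max_card.
- by apply/subsetP => _ /imsetP[w /andP[ws _] ->]; apply: imset_f.
- apply/subsetP => _ /imsetP[w /andP[/= ws uw] ->].
  by apply: (subsetP (XY uw (ule w ws))); apply: phiX.
- apply: leq_trans (leq_imset_card _ _) _; apply: leq_trans (deg_le u).
  by apply/subset_leq_card/subsetP => w /andP[_ uw]; rewrite inE.
exists (fun w => if w == u then x else phi w).
have neq w : w \in s -> (w == u) = false.
  by move=> ws; apply: contraNF us => /eqP<-.
have xphi w : w \in s -> x <> phi w.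
  by move=> ws xw; case/negP: xW; rewrite xw imset_f.
split=> [v w|w|v w]; rewrite !inE.
- move=> /predU1P[->|vs] /predU1P[->|ws]; rewrite ?eqxx ?neq //.
  + by move/xphi => /(_ ws).
  + by move/esym/xphi => /(_ vs).
  + exact: inj_phi.
- by case/predU1P=> [->|ws]; rewrite ?eqxx ?neq //; apply: phiX.
move=> /predU1P[->|vs] /predU1P[->|ws]; rewrite ?eqxx ?neq //.
- by rewrite adj_irrefl.
- by move=> uw _; apply/xE/imset_f; rewrite inE ws.
- by move=> _; rewrite ltnNge; case/negP; apply: ule.
- exact: phiE.
Qed.

End Greedy.

(** * Criteria for canonical copies *)

Section Canonical.

Variables (H : sgraph) (N : nat) (col : coloring N) (phi : H -> 'I_N).

Lemma mem_edges (u w : H) : adj u w -> [set u; w] \in edges H.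
Proof. by move=> uw; apply/imsetP; exists (u, w); rewrite ?inE. Qed.

Lemma edgesP (e : {set H}) :
  reflect (exists u w, adj u w /\ e = [set u; w]) (e \in edges H).
Proof.
apply: (iffP imsetP) => [[[u w]]|[u [w [uw ->]]]].
  by rewrite inE /= => uw ->; exists u, w.
by exists (u, w); rewrite ?inE.
Qed.

Lemma imset_pair (T : finType) (f : H -> T) (u w : H) :
  f @: [set u; w] = [set f u; f w].
Proof. by rewrite imsetU1 imset_set1. Qed.

Lemma monochromaticI a :
  (forall u w, adj u w -> col [set phi u; phi w] = a) -> monochromatic col phi.
Proof.
move=> mono e e' /edgesP[u [w [uw ->]]] /edgesP[u' [w' [uw' ->]]].
by rewrite !imset_pair !mono.
Qed.

(** The second of two distinct edges has an endpoint off the first, and by symmetry of [adj] it may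
    be called [w']. *)
Lemma rainbowI :
  (forall u w u' w', adj u w -> adj u' w' -> w' != u -> w' != w ->
     col [set phi u; phi w] <> col [set phi u'; phi w']) ->
  rainbow col phi.
Proof.
move=> rb e e' /edgesP[u [w [uw ->]]] /edgesP[u' [w' [uw' ->]]] /=.
rewrite !imset_pair => eq_col.
have in2 x y z : x != y -> x != z -> x \notin [set y; z].
  by rewrite !inE negb_or => -> ->.
have uw_u' : (u' == u) || (u' == w).
  apply: contraPT eq_col; rewrite negb_or => /andP[? ?].
  by rewrite [in RHS]setUC; apply: rb; rewrite // adj_sym.
have uw_w' : (w' == u) || (w' == w).
  by apply: contraPT eq_col; rewrite negb_or => /andP[? ?]; apply: rb.
have: u' != w' by apply: contraTneq uw' => ->; rewrite adj_irrefl.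
case/orP: uw_u' => /eqP->; case/orP: uw_w' => /eqP->; rewrite ?eqxx //.
by rewrite setUC.
Qed.

(** Sorting by [r] gives the ordering. Vertices of equal rank are non-adjacent, so their relative
    order is irrelevant. *)
Lemma lexicographicI (r c : H -> nat) :
  (forall u w, adj u w -> r u != r w) -> injective c ->
  (forall u w, adj u w -> r u < r w -> col [set phi u; phi w] = c u) ->
  lexicographic col phi.
Proof.
move=> r_proper inj_c col_c.
pose s := sort (relpre r leq) (enum H).
have sz : size s = #|H| by rewrite size_sort -cardE.
have s_uniq : uniq s by rewrite sort_uniq enum_uniq.
have s_sorted : sorted (relpre r leq) s.
  by apply: sort_sorted => u w; apply: leq_total.
pose v (i : 'I_#|H|) := nth (enum_val i) s i.
have vE (x0 : H) (i : 'I_#|H|) : v i = nth x0 s i by apply: set_nth_default; rewrite sz.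
have v_inj : injective v.
  move=> i j; rewrite (vE (enum_val i) i) (vE (enum_val i) j) => /eqP.
  by rewrite nth_uniq ?sz // => /eqP/val_inj.
exists v, (c \o v); split.
- by apply: inj_card_bij; rewrite ?card_ord.
- exact: inj_comp.
move=> i j ij aij; rewrite imset_pair; apply: col_c => //.
rewrite ltn_neqAle r_proper //= (vE (enum_val i) i) (vE (enum_val i) j).
apply: (sorted_leq_nth _ _ _ s_sorted); rewrite ?inE ?sz ?ltn_ord 1?ltnW //.
- by move=> y x z; apply: leq_trans.
- by move=> x /=.
Qed.

End Canonical.

(** * Counting forms of the probabilistic arguments *)

Lemma card_dep_pairs (A B : finType) (P : {pred A}) (F : A -> {set B}) :
  #|[set p : A * B | (p.1 \in P) && (p.2 \in F p.1)]| = \sum_(a in P) #|F a|.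
Proof.
rewrite -sum1dep_card -(pair_big_dep (mem P) (fun a b => b \in F a) (fun _ _ => 1)) /=.
by apply: eq_bigr => a _; rewrite sum1_card.
Qed.

Lemma card_exists_le (A B : finType) (P : {pred A}) (F : B -> pred A) :
  #|[set a in P | [exists b, F b a]]| <= \sum_b #|[set a in P | F b a]|.
Proof.
rewrite -sum1dep_card.
under [leqRHS]eq_bigr do rewrite -sum1dep_card big_mkcond.
rewrite exchange_big [leqLHS]big_mkcond /=; apply: leq_sum => a _.
by case: ifP => // /andP[aP /existsP[b Fba]]; rewrite (bigD1 b) //= aP Fba.
Qed.

(* Resampling: [(f, s) |-> (f with f l replaced by s, f l)] is injective. *)
Lemma card_ffun_coordinate (I T : finType) (S : {set T}) (l : I)
    (B : {ffun I -> T} -> {set T}) (b : nat) :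
  (forall f g : {ffun I -> T}, (forall i, i != l -> f i = g i) -> B f = B g) ->
  (forall f, f \in ffun_on S -> #|B f| <= b) ->
  #|[set f in ffun_on S | f l \in B f]| * #|S| <= #|S| ^ #|I| * b.
Proof.
move=> B_indep B_le.
pose upd (f : {ffun I -> T}) s : {ffun I -> T} := [ffun i => if i == l then s else f i].
pose h (p : {ffun I -> T} * T) := (upd p.1 p.2, p.1 l).
have updS f s : f \in ffun_on S -> s \in S -> upd f s \in ffun_on S.
  move=> /ffun_onP fS sS; apply/ffun_onP => i; rewrite ffunE.
  by case: eqP => // _; apply: fS.
have updB f s : B (upd f s) = B f.
  by apply: B_indep => i /negPf il; rewrite ffunE il.
rewrite -cardsX -(card_in_imset (f := h)); last first.
  move=> [f s] [g s'] _ _ [/ffunP fg fgl]; congr (_, _); last first.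
    by have := fg l; rewrite !ffunE eqxx.
  apply/ffunP => i; have := fg i; rewrite !ffunE.
  by case: eqP => // ->.
apply: (@leq_trans (\sum_(f in ffun_on S) #|B f|)); last first.
  apply: (@leq_trans (\sum_(f in ffun_on S) b)); first exact: leq_sum.
  by rewrite sum_nat_const card_ffun_on.
rewrite -card_dep_pairs; apply/subset_leq_card/subsetP => _ /imsetP[[f s] + ->].
rewrite in_setX !in_set /= => /andP[/andP[fS flB] sS].
by rewrite updS // updB flB.
Qed.

(* Union bound for a random [f : I -> S]: given its other values, [f m] has to
   avoid [V0], [f l] and a colour neighbourhood of [f l], each of size at most
   [#|S| / q]. *)
Lemma rainbow_clique (I T : finType) (k : T -> T -> nat) (S V0 : {set T}) (q : nat) :
  1 < #|I| -> 3 * #|I| ^ 4 < q -> q <= #|S| -> #|V0| * q <= #|S| ->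
  (forall z (a : nat), z \in S -> z \notin V0 ->
     #|[set w in S | (w != z) && (k z w == a)]| * q <= #|S|) ->
  exists f : I -> T, injective f /\
    forall i j l m, m != l -> m != i -> m != j -> k (f i) (f j) <> k (f l) (f m).
Proof.
move=> I_gt1 q_gt qS V0_le deg_le.
have S_gt0 : 0 < #|S| by lia.
(* The colour neighbourhood is included only when [f l] lies in [S] and outside [V0], where [deg_le]
   bounds its size. For the final [f] this guard always holds. *)
pose nbr x (a : nat) := [set w in S | (w != x) && (k x w == a)].
pose B (p : I * I * (I * I)) (f : {ffun I -> T}) :=
  let: (i, j, (l, m)) := p in
  V0 :|: [set f l] :|:
  (if (f l \in S) && (f l \notin V0) then nbr (f l) (k (f i) (f j)) else set0).
pose bad (p : I * I * (I * I)) (f : {ffun I -> T}) :=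
  let: (i, j, (l, m)) := p in [&& m != l, m != i, m != j & f m \in B p f].
have bad_le p : #|[set f in ffun_on S | bad p f]| * q <= 3 * #|S| ^ #|I|.
  case: p => [[i j] [l m]].
  have [/and3P[ml mi mj]|mN] := boolP [&& m != l, m != i & m != j]; last first.
    rewrite (_ : [set _ in _ | _] = set0) ?cards0 //; apply/setP => f.
    by rewrite in_set0 in_set /=; apply: contraNF mN => /andP[_ /and4P[-> -> ->]].
  have B_le f : #|B (i, j, (l, m)) f| <= (3 * #|S|) %/ q.
    rewrite leq_divRL; last by lia.
    apply: (@leq_trans ((#|V0| + 1 + #|(if (f l \in S) && (f l \notin V0)
      then nbr (f l) (k (f i) (f j)) else set0)|) * q)).
      rewrite leq_mul2r; apply/orP; right; apply: leq_trans (leq_card_setU _ _) _.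
      rewrite leq_add2r; apply: leq_trans (leq_card_setU _ _) _.
      by rewrite cards1.
    rewrite !mulnDl mul1n.
    case: ifP => [/andP[flS flV]|_]; last by rewrite cards0; lia.
    by have := deg_le _ (k (f i) (f j)) flS flV; rewrite -/(nbr _ _); lia.
  have := @card_ffun_coordinate I T S m (B (i, j, (l, m))) _ _ (fun f _ => B_le f).
  rewrite (_ : [set f in ffun_on S | bad (i, j, (l, m)) f] =
    [set f in ffun_on S | f m \in B (i, j, (l, m)) f]); last first.
    by apply/setP => f; rewrite in_set [RHS]in_set /bad ml mi mj.
  move=> card_le; rewrite -(leq_pmul2r S_gt0) mulnAC.
  apply: (@leq_trans (#|S| ^ #|I| * (3 * #|S| %/ q) * q)).
    rewrite leq_mul2r card_le ?orbT // => f g fg.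
    by rewrite /B !fg // eq_sym.
  by rewrite (mulnC 3 (_ ^ _)) -!mulnA leq_mul2l leq_trunc_div orbT.
have : #|[set f in ffun_on S | [exists p, bad p f]]| < #|S| ^ #|I|.
  have SI_gt0 : 0 < #|S| ^ #|I| by rewrite expn_gt0 S_gt0.
  have q_gt0 : 0 < q by lia.
  rewrite -(ltn_pmul2r q_gt0).
  apply: (@leq_ltn_trans (#|I| ^ 4 * (3 * #|S| ^ #|I|))).
    apply: (@leq_trans (\sum_p #|[set f in ffun_on S | bad p f]| * q)).
      by rewrite -big_distrl leq_mul2r card_exists_le orbT.
    apply: (@leq_trans (\sum_(p : I * I * (I * I)) 3 * #|S| ^ #|I|)).
      by apply: leq_sum => p _; apply: bad_le.
    by rewrite sum_nat_const !card_prod !expnS expn0 muln1 !mulnA.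
  by rewrite mulnA mulnC (mulnC _ 3) ltn_pmul2l.
rewrite -(@card_ffun_on I T (mem S)) => lt_bad.
have [f fS fN] : exists2 f : {ffun I -> T}, f \in ffun_on S & ~~ [exists p, bad p f].
  apply/exists_inP; apply: contraTT lt_bad; rewrite negb_exists_in -leqNgt => /forall_inP allB.
  by apply/subset_leq_card/subsetP => f fS; rewrite in_set fS -[[exists _, _]]negbK allB.
have {}fN i j l m : m != l -> m != i -> m != j -> f m \notin B (i, j, (l, m)) f.
  move=> ml mi mj; apply: contraNN fN => fB; apply/existsP; exists (i, j, (l, m)).
  by rewrite /= ml mi mj.
have {}fS i : f i \in S by move/ffun_onP: fS.
have fV m : f m \notin V0.
  have [l lm] : exists l, l != m.
    have /card_gt0P[l] : 0 < #|predC1 m| by have := cardC1 m; lia.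
    by exists l.
  rewrite eq_sym in lm; apply: contra (fN l l l m lm lm lm).
  by rewrite !in_setU => ->.
exists f; split=> [i j fij|i j l m ml mi mj kE].
  apply/eqP; apply: contraT => ij.
  case/negP: (fN j j j i ij ij ij).
  by rewrite !in_setU in_set1 fij eqxx orbT.
have fml : f m != f l.
  apply: contraNneq (fN l l l m ml ml ml) => fml.
  by rewrite !in_setU in_set1 fml eqxx orbT.
case/negP: (fN i j l m ml mi mj); rewrite !in_setU fS fV /= in_set.
by rewrite fS fml kE eqxx !orbT.
Qed.

(* [U] is the set of vertices of [V0] adjacent to [d + 1] random vertices of [S]
   (sampled by [f]): on average it has [#|S| / q ^ (d + 2)] elements, while a set
   of [d] vertices with fewer than [n] common neighbours lies in it with
   probability less than [(n / #|S|) ^ (d + 1)]. *)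
Lemma dependent_random_choice (T : finType) (E : rel T) (S V0 : {set T}) (q d n : nat) :
  0 < n -> 0 < q -> V0 \subset S -> #|S| <= #|V0| * q ->
  (forall v, v \in V0 -> #|S| <= #|[set w in S | E v w]| * q) ->
  2 * n ^ d.+1 * q ^ d.+2 <= #|S| ->
  exists U : {set T}, [/\ U \subset S, #|S| <= #|U| * (2 * q ^ d.+2) &
    forall Q : {set T}, Q \subset U -> #|Q| <= d ->
      n <= #|[set w in S | [forall v in Q, E v w]]|].
Proof.
move=> n_gt0 q_gt0 V0S V0_ge deg_ge S_ge.
pose s := #|S|; pose A (f : {ffun 'I_d.+1 -> T}) := [set v in V0 | [forall i, E v (f i)]].
have qd_gt0 : 0 < q ^ d.+2 by rewrite expn_gt0 q_gt0.
have n_le : n <= s.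
  apply: leq_trans S_ge; rewrite -mulnA mulnCA (expnS n) -mulnA leq_pmulr //.
  by rewrite muln_gt0 expn_gt0 n_gt0 muln_gt0 qd_gt0.
have s_gt0 : 0 < s := leq_trans n_gt0 n_le.
(* A set of at most [d] vertices is represented by a [d]-tuple [g], possibly with repetitions. A
   sample is bad when it lies in a common neighbourhood with fewer than [n] elements. *)
pose common (g : {ffun 'I_d -> T}) := [set w in S | [forall i, E (g i) w]].
pose bad (f : {ffun 'I_d.+1 -> T}) :=
  [exists g : {ffun 'I_d -> T},
     [&& g \in ffun_on S, #|common g| < n & [forall i, f i \in common g]]].
have card_on m (B : {set T}) : #|(ffun_on B : {pred {ffun 'I_m -> T}})| = #|B| ^ m.
  by rewrite card_ffun_on card_ord.
have bad_le : #|[set f in ffun_on S | bad f]| <= s ^ d * n ^ d.+1.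
  apply: leq_trans (card_exists_le _ _) _.
  rewrite -card_on -sum_nat_const [leqRHS]big_mkcond.
  apply: leq_sum => g _.
  have [gS|gN] := boolP (g \in ffun_on S); last first.
    rewrite (_ : [set _ in _ | _] = set0) ?cards0 //.
    by apply/setP => f; rewrite in_set in_set0 /= andbF.
  have [lt_n|ge_n] := ltnP #|common g| n; last first.
    rewrite (_ : [set _ in _ | _] = set0) ?cards0 //.
    by apply/setP => f; rewrite in_set in_set0 /= andbF.
  apply: (@leq_trans (#|common g| ^ d.+1)); last by rewrite leq_exp2r // ltnW.
  rewrite -card_on.
  apply/subset_leq_card/subsetP => f; rewrite in_set => /andP[_ /forallP fg].
  by apply/ffun_onP.
have sumA : \sum_(f in ffun_on S) #|A f| = \sum_(v in V0) #|[set w in S | E v w]| ^ d.+1.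
  under eq_bigr do rewrite -sum1dep_card big_mkcondr.
  rewrite exchange_big /=; apply: eq_bigr => v _.
  rewrite -big_mkcondr sum1_card -card_on.
  apply: eq_card => f; apply/andP/ffun_onP => [[/ffun_onP fS /forallP vf] i|fE].
    by rewrite in_set fS vf.
  split; last by apply/forallP => i; have := fE i; rewrite in_set => /andP[].
  by apply/ffun_onP => i; have := fE i; rewrite in_set => /andP[].
have sumA_ge : s ^ d.+2 <= (\sum_(f in ffun_on S) #|A f|) * q ^ d.+2.
  rewrite sumA (expnS q) mulnCA big_distrl /= mulnC (expnS s).
  apply: (@leq_trans ((\sum_(v in V0) s ^ d.+1) * q)).
    rewrite sum_nat_const mulnAC; exact: leq_mul.
  rewrite leq_mul2r; apply/orP; right; apply: leq_sum => v vV0.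
  by rewrite -expnMn leq_exp2r // deg_ge.
have [f fS fU] : exists2 f : {ffun 'I_d.+1 -> T}, f \in ffun_on S &
    ~~ bad f && (s <= #|A f| * (2 * q ^ d.+2)).
  apply/exists_inP; apply: contraT; rewrite negb_exists_in => /forall_inP allN.
  (* If every sample were bad or gave a small [A f], this would hold termwise. But the left side is
     at least [2 * s ^ d.+2 + s ^ d.+1], and the right side at most [2 * s ^ d.+2]. *)
  have: \sum_(f in ffun_on S) (#|A f| * (2 * q ^ d.+2)).+1 <=
      \sum_(f : {ffun 'I_d.+1 -> T} | f \in ffun_on S) (s + bad f * (s * (2 * q ^ d.+2))).
    apply: leq_sum => f fS; have := allN f fS; rewrite negb_and negbK -ltnNge.
    case: (bad f) => /= [_|]; last by rewrite mul0n addn0.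
    rewrite mul1n -addn1 addnC leq_add // leq_mul2r subset_leq_card ?orbT //.
    by apply: subset_trans V0S; apply/subsetP => v; rewrite in_set => /andP[].
  rewrite -(eq_bigr _ (fun f _ => addn1 _)) !big_split /= -!big_distrl /=.
  rewrite !sum_nat_const card_ffun_on card_ord -/s muln1.
  have -> : \sum_(f in ffun_on S) nat_of_bool (bad f) = #|[set f in ffun_on S | bad f]|.
    by rewrite -sum1dep_card big_mkcondr; apply: eq_bigr => f _; case: (bad f).
  have sd_gt0 : 0 < s ^ d.+1 by rewrite expn_gt0 s_gt0.
  rewrite -expnSr mulnCA.
  have: #|[set f in ffun_on S | bad f]| * (s * (2 * q ^ d.+2)) <= s ^ d.+2.
    apply: (@leq_trans (s ^ d * n ^ d.+1 * (s * (2 * q ^ d.+2)))).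
      by rewrite leq_mul2r bad_le orbT.
    rewrite mulnACA -expnSr [s ^ d.+2]expnSr leq_mul2l; apply/orP; right.
    by rewrite mulnA (mulnC _ 2).
  move: sumA_ge sd_gt0; move: (_ * (s * _)) (_ * q ^ _) (s ^ d.+1) (s ^ d.+2); lia.
case/andP: fU => fgood fU.
have AS : A f \subset S.
  by apply: subset_trans V0S; apply/subsetP => v; rewrite in_set => /andP[].
exists (A f); split=> // Q QA Q_le.
(* A nonempty [Q] is padded to a [d]-tuple by repeating [x0]; the empty set is settled by
   [n <= s]. *)
have [->|/set0Pn[x0 x0Q]] := eqVneq Q set0.
  apply: (@leq_trans s); last first.
    apply/subset_leq_card/subsetP => w wS; rewrite in_set wS.
    by apply/forall_inP => v; rewrite in_set0.
  exact: n_le.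
have [g gQ] : exists g : 'I_d -> T, forall v, v \in Q <-> exists i, g i = v.
  exists (fun i => nth x0 (enum Q) i) => v; split=> [vQ|[i <-]].
    have iQ : index v (enum Q) < #|Q| by rewrite cardE index_mem mem_enum.
    by exists (Ordinal (leq_trans iQ Q_le)); rewrite nth_index // mem_enum.
  rewrite -mem_enum; have [lt|ge] := ltnP i (size (enum Q)); first exact: mem_nth.
  by rewrite nth_default // mem_enum.
have gA i : g i \in A f by apply: (subsetP QA); apply/gQ; exists i.
apply: contraNT fgood; rewrite -ltnNge => lt_n; apply/existsP; exists (finfun g).
apply/and3P; split.
- by apply/ffun_onP => i; rewrite ffunE; apply: (subsetP AS).
- apply: leq_ltn_trans lt_n; apply/subset_leq_card/subsetP => w.
  rewrite [w \in common _]in_set => /andP[wS /forallP gw]; rewrite in_set wS /=.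
  by apply/forall_inP => v /gQ[i <-]; have := gw i; rewrite ffunE.
apply/forallP => i; rewrite in_set; have /ffun_onP -> /= := fS.
apply/forallP => j; rewrite ffunE.
by have := gA j; rewrite in_set => /andP[_ /forallP/(_ i)].
Qed.

(** * Upper bounds: finding canonical copies *)

Lemma exists_notin (T : finType) (X W : {set T}) : #|W| < #|X| -> exists2 x, x \in X & x \notin W.
Proof.
move=> WX; have /subsetPn[x] : ~~ (X \subset W); last by exists x.
by apply: contraTN WX => /subset_leq_card; rewrite leqNgt.
Qed.

Section UpperBounds.

Variables (H : sgraph) (N d : nat) (col : coloring N).
Hypothesis H_gt1 : 1 < #|H|.
Hypothesis deg_le : forall v : H, #|[set w | adj v w]| <= d.

Local Notation n := #|H|.
Local Notation k x y := (col [set x; y]).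

Definition has_canonical_copy : Prop :=
  exists phi : H -> 'I_N, injective phi /\ canonically_colored col phi.

Definition color_nbhd (S : {set 'I_N}) v a := [set w in S | (w != v) && (k v w == a)].

Lemma rainbow_copy (S V0 : {set 'I_N}) q :
  3 * n ^ 4 < q -> q <= #|S| -> #|V0| * q <= #|S| ->
  (forall v a, v \in S -> v \notin V0 -> #|color_nbhd S v a| * q <= #|S|) ->
  has_canonical_copy.
Proof.
move=> q_gt qS V0_le nbhd_le.
have [phi [phi_inj rb]] :=
  @rainbow_clique H 'I_N (fun x y => k x y) S V0 q H_gt1 q_gt qS V0_le nbhd_le.
exists phi; split=> //; apply: Or32; apply: rainbowI => u w u' w' _ uw' w'u w'w.
by apply: rb => //; apply: contraTneq uw' => ->; rewrite adj_irrefl.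
Qed.

Lemma bipartite_canonical_copy (side : H -> bool) q :
  0 < d -> (forall u w, adj u w -> side u != side w) ->
  3 * n ^ 4 < q -> 2 * n ^ d.+1 * q ^ d.+2 <= N -> has_canonical_copy.
Proof.
move=> d_gt0 side_proper q_gt N_ge.
have n_gt0 : 0 < n := ltnW H_gt1.
have q_gt0 : 0 < q by lia.
pose S := [set: 'I_N].
have cardS : #|S| = N by rewrite cardsT card_ord.
have qS : q <= #|S|.
  rewrite cardS; apply: leq_trans N_ge; rewrite (expnS q) mulnCA leq_pmulr //.
  by rewrite muln_gt0 muln_gt0 (expn_gt0 n) (expn_gt0 q) n_gt0 q_gt0.
pose heavy v a := #|S| <= #|color_nbhd S v a| * q.
(* A popular colour at [v] if there is one. The default 0 may fail to be popular, which is why [V0]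
   tests [heavy v (c v)]. *)
pose c v := if [pick w | heavy v (k v w)] is Some w then k v w else 0.
pose V0 := [set v | heavy v (c v)].
have heavyV0 v a : heavy v a -> v \in V0.
  move=> va; rewrite in_set /c; case: pickP => // noheavy.
  have /card_gt0P[w] : 0 < #|color_nbhd S v a|.
    move: va; rewrite /heavy cardS; have : 0 < N by rewrite -cardS; lia.
    by case: #|_| => //; lia.
  by rewrite in_set => /and3P[_ _ /eqP wa]; have := noheavy w; rewrite wa va.
have [le_S|lt_S] := leqP #|S| (#|V0| * q); last first.
  apply: (rainbow_copy q_gt qS (ltnW lt_S)) => v a _ vN.
  by apply/ltnW; rewrite ltnNge; apply: contraNN vN; apply: heavyV0.
have [||U [_ U_ge U_common]] := @dependent_random_choice 'I_N
  (fun v w => (w != v) && (k v w == c v)) S V0 q d n n_gt0 q_gt0 (subsetT _) le_S.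
- by move=> v; rewrite in_set.
- by rewrite cardS.
have U_gt : n.-1 * n.-1 < size (enum U).
  rewrite -cardE; apply: (@leq_trans (n ^ 2)).
    by case: (n) n_gt0 => // m _ /=; rewrite expnS expn1; lia.
  have D_gt0 : 0 < 2 * q ^ d.+2 by rewrite muln_gt0 expn_gt0 q_gt0.
  rewrite -(leq_pmul2r D_gt0); apply: leq_trans U_ge; rewrite cardS.
  apply: leq_trans N_ge; rewrite mulnCA mulnA leq_mul2r; apply/orP; right.
  by rewrite leq_mul2l /= leq_exp2l.
have [t tU t_ok] := pigeonhole_subseq c (enum_uniq U) U_gt.
have t_uniq : uniq t := subseq_uniq tU (enum_uniq U).
pose U' := [set x in t].
have U'U : U' \subset U.
  by apply/subsetP => x; rewrite in_set => /(mem_subseq tU); rewrite mem_enum.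
have cardU' : n <= #|U'|.
  rewrite cardsE (card_uniqP t_uniq) -(prednK n_gt0).
  by case: t_ok => [[]|[]].
(* The rank is the truth value of [side]: the vertices with [side] true go first, into [U'], and
   each other vertex then goes to a common out-neighbour of its placed neighbours. *)
have [|||phi [phi_inj phiX phiE]] := @greedy_embedding H 'I_N d (fun u => side u)
  (fun u => if side u then U' else setT) (fun u => if side u then set0 else U)
  (fun=> setT) (fun u x y => side u || (k y x == c y)) deg_le.
- by move=> u w _ _; apply: subsetT.
- by move=> u w /side_proper; case: (side u); case: (side w).
- move=> u W Q _ W_lt QW; case: (side u) => QY Q_le /=.
    by have [x xU' xW] := exists_notin (leq_trans W_lt cardU'); exists x.
  have [x] := exists_notin (leq_trans W_lt (U_common Q QY Q_le)).
  rewrite in_set => /andP[_ /forall_inP xQ] xW; exists x; split=> [||y yQ] //; first exact: in_setT.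
  by have /andP[] := xQ y yQ.
exists phi; split=> //.
have kE u w : adj u w -> side u -> k (phi u) (phi w) = c (phi u).
  move=> uw su; have := phiE w u; rewrite adj_sym su => /(_ uw).
  have /negPf-> : ~~ side w by have := side_proper _ _ uw; rewrite su; case: (side w).
  by move=> /(_ isT) /eqP.
have phit u : side u -> phi u \in t by move=> su; have := phiX u; rewrite su in_set.
case: t_ok => [[_ c_inj]|[_ [a ca]]]; [apply: Or33|apply: Or31].
  pose b := \max_(u : H) c (phi u).
  have c_le u : c (phi u) <= b by apply: leq_bigmax.
  (* The vertices of the second side have no later neighbour, so any fresh
     colours will do for them. *)
  apply: (@lexicographicI _ _ _ _ (fun u => ~~ side u)
    (fun u => if side u then c (phi u) else b.+1 + enum_rank u)).
  - by move=> u w /side_proper; case: (side u); case: (side w).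
  - move=> u w; case: ifP => su; case: ifP => sw.
    + by move=> cE; apply/phi_inj/c_inj => //; apply: phit.
    + by have := c_le u; lia.
    + by have := c_le w; lia.
    + by move/addnI/val_inj/enum_rank_inj.
  move=> u w uw; case: (boolP (side u)) => su; last by case: (side w).
  by move=> _; apply: kE.
apply: (@monochromaticI _ _ _ _ a) => u w uw.
case: (boolP (side u)) => su; first by rewrite kE // ca // phit.
have sw : side w by have := side_proper _ _ uw; move: su; case: (side u); case: (side w).
by rewrite setUC kE 1?adj_sym // ca // phit.
Qed.

(** The used vertices [W] are confined to [S], so that a single vertex of [P] outside [S] can serve
    every [W] and [Q]. *)
Definition weak_step (P S : {set 'I_N}) a : Prop :=
  forall W Q : {set 'I_N}, W \subset S -> #|W| < n -> Q \subset W -> #|Q| <= d ->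
    exists x, [/\ x \in P, x \notin W & {in Q, forall y, k x y = a}].

(** With [n] common neighbours, any fewer than [n] used vertices can be avoided, even those outside
    [S]. This lets several vertices be placed in the same step. *)
Definition strong_step (P S : {set 'I_N}) a : Prop :=
  forall Q : {set 'I_N}, Q \subset S -> #|Q| <= d ->
    n <= #|[set w in P | [forall v in Q, (w != v) && (k v w == a)]]|.

Lemma strong_stepP (P S : {set 'I_N}) a : strong_step P S a ->
  forall W Q : {set 'I_N}, #|W| < n -> Q \subset S -> #|Q| <= d ->
    exists x, [/\ x \in P, x \notin W & {in Q, forall y, k x y = a}].
Proof.
move=> PS W Q W_lt QS Q_le; have [x] := exists_notin (leq_trans W_lt (PS Q QS Q_le)).
rewrite in_set => /andP[xP /forall_inP xQ] xW; exists x; split=> // y yQ.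
by have /andP[_ /eqP <-] := xQ y yQ; rewrite setUC.
Qed.

Lemma strong_step_weak (P S : {set 'I_N}) a : strong_step P S a -> weak_step P S a.
Proof.
by move=> PS W Q WS W_lt QW; apply: (strong_stepP PS) => //; apply: subset_trans WS.
Qed.

(** [F] lists the earlier colours. If one of them is dense, dependent random choice gives a strong
    step. If a new colour is popular at some [v], the neighbourhood of [v] in it gives a weak step.
    Otherwise few vertices have a popular colour, and there is a rainbow copy. *)
Lemma step_or_rainbow (F : seq nat) (m q : nat) (S : {set 'I_N}) :
  0 < m -> size F <= m -> 3 * n ^ 4 < q -> 2 * n ^ d.+1 * (m * q) ^ d.+2 <= #|S| ->
  has_canonical_copy \/
  exists (S' : {set 'I_N}) a, [/\ S' \subset S, #|S| <= #|S'| * (2 * (m * q) ^ d.+2),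
    weak_step S S' a & a \in F -> strong_step S S' a].
Proof.
move=> m_gt0 F_le q_gt S_ge.
have n_gt0 : 0 < n := ltnW H_gt1.
have q_gt0 : 0 < q by lia.
have mq_gt0 : 0 < m * q by rewrite muln_gt0 m_gt0.
have mqS : m * q <= #|S|.
  apply: leq_trans S_ge; rewrite (expnS (m * q)) mulnCA leq_pmulr //.
  by rewrite muln_gt0 muln_gt0 (expn_gt0 n) (expn_gt0 (m * q)) n_gt0 mq_gt0.
pose heavy v a := #|S| <= #|color_nbhd S v a| * q.
pose V a := [set v in S | heavy v a].
have [/hasP[a aF Va]|/hasPn sparse] := boolP (has (fun a => #|S| <= #|V a| * (m * q)) F).
  right; have [||S' [S'S S'_ge S'_common]] := @dependent_random_choice 'I_N
    (fun v w => (w != v) && (k v w == a)) S (V a) (m * q) d n n_gt0 mq_gt0 _ Va _ S_ge.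
  - by apply/subsetP => v; rewrite in_set => /andP[].
  - move=> v; rewrite in_set => /andP[_ va]; apply: leq_trans va _.
    by rewrite leq_mul2l leq_pmull ?orbT.
  by exists S', a; split=> //; apply: strong_step_weak.
have [/exists_inP[v vS /existsP[w /andP[va aF]]]|no_new] :=
    boolP [exists v in S, exists w, heavy v (k v w) && (k v w \notin F)].
  right; exists (color_nbhd S v (k v w)), (k v w); split.
  - by apply/subsetP => x; rewrite in_set => /andP[].
  - apply: leq_trans va _; rewrite leq_mul2l; apply/orP; right.
    apply: (@leq_trans (m * q)); first by rewrite leq_pmull.
    by rewrite (expnS (m * q)) mulnCA leq_pmulr // muln_gt0 expn_gt0 mq_gt0.
  - move=> W Q WS _ QW _; exists v; split=> //.
      by apply/negP => /(subsetP WS); rewrite !inE eqxx andbF.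
    by move=> y /(subsetP QW)/(subsetP WS); rewrite !inE => /and3P[_ _ /eqP].
  - by rewrite (negPf aF).
left; apply: (@rainbow_copy S (\bigcup_(a <- F) V a) q) => //.
- by apply: leq_trans mqS; rewrite leq_pmull.
(* Each [V a] has fewer than [#|S| / (m * q)] elements and [F] at most [m] colours, so the union has
   at most [#|S| / q] elements. *)
- rewrite -(leq_pmul2l m_gt0) mulnCA.
  apply: (@leq_trans (size F * #|S|)); last by rewrite leq_mul2r F_le orbT.
  elim: F {F_le no_new} sparse => [|a F IHF] sparse; first by rewrite big_nil cards0.
  rewrite big_cons; apply: (@leq_trans ((#|V a| + #|\bigcup_(b <- F) V b|) * (m * q))).
    by rewrite leq_mul2r leq_card_setU orbT.
  rewrite mulnDl mulSn leq_add //; last first.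
    by apply: IHF => b bF; apply: sparse; rewrite inE bF orbT.
  by rewrite ltnW // ltnNge sparse // inE eqxx.
move=> v a vS vN; apply/ltnW; rewrite ltnNge; apply/negP => va.
have [aF|aF] := boolP (a \in F).
  case/negP: vN; rewrite (big_rem a) //= in_setU in_set vS.
  by rewrite -/(heavy v a) /heavy va.
case/negP: no_new; apply/exists_inP; exists v => //.
have /card_gt0P[w] : 0 < #|color_nbhd S v a|.
  have S_gt0 := leq_trans mq_gt0 mqS.
  by move: va; case: #|color_nbhd _ _ _| => //; lia.
by rewrite in_set => /and3P[_ _ /eqP wa]; apply/existsP; exists w; rewrite wa /heavy va.
Qed.

(** Only the first occurrence of a colour may be a merely weak step. *)
Definition chain K (S : nat -> {set 'I_N}) (c : nat -> nat) : Prop :=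
  forall i, i < K -> [/\ S i.+1 \subset S i, weak_step (S i) (S i.+1) (c i) &
    forall j, j < i -> c j = c i -> strong_step (S i) (S i.+1) (c i)].

Lemma chain_or_rainbow (K q : nat) :
  0 < K -> 3 * n ^ 4 < q ->
  2 * n ^ d.+1 * (K * q) ^ d.+2 * (2 * (K * q) ^ d.+2) ^ K <= N ->
  has_canonical_copy \/ exists S c, chain K S c.
Proof.
move=> K_gt0 q_gt N_ge; set D := 2 * (K * q) ^ d.+2 in N_ge.
have D_gt0 : 0 < D by rewrite muln_gt0 expn_gt0 muln_gt0 K_gt0; case: (q) q_gt.
(* Each step divides the size by at most [D], and the bound on [N] leaves enough for a further step
   whenever [m < K]. *)
suff /(_ K (leqnn K)) : forall m, m <= K -> has_canonical_copy \/
    exists S c, chain m S c /\ N <= #|S m| * D ^ m.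
  by move=> [|[S [c [Sc _]]]]; [left|right; exists S, c].
elim=> [_|m IHm lt_mK].
  by right; exists (fun=> setT), (fun=> 0); rewrite cardsT card_ord muln1; split.
have [|[S [c [Sc S_ge]]]] := IHm (ltnW lt_mK); first by left.
have F_le : size [seq c i | i <- iota 0 m] <= K by rewrite size_map size_iota ltnW.
have [||[S' [a [S'S S'_ge weak strong]]]] := step_or_rainbow K_gt0 F_le q_gt (S := S m).
- have DK_gt0 : 0 < D ^ K by rewrite expn_gt0 D_gt0.
  rewrite -(leq_pmul2r DK_gt0); apply: leq_trans N_ge (leq_trans S_ge _).
  by rewrite leq_mul2l leq_pexp2l ?orbT // ltnW.
- by left.
right; exists (fun i => if i == m.+1 then S' else S i), (fun i => if i == m then a else c i).
split; last first.
  by rewrite eqxx; apply: leq_trans S_ge _; rewrite expnS mulnA leq_mul2r S'_ge orbT.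
move=> i; rewrite ltnS leq_eqVlt eqSS => /predU1P[->|lt_im].
  rewrite !eqxx (_ : m == m.+1 = false); last by lia.
  split=> // j lt_jm; rewrite (_ : j == m = false); last by lia.
  by move=> ja; apply: strong; rewrite -ja map_f // mem_iota add0n.
rewrite (_ : i == m.+1 = false) 1?(_ : i == m = false); try by lia.
have [? ? strong_i] := Sc i lt_im; split=> // j lt_ji; rewrite (_ : j == m = false); last by lia.
exact: strong_i.
Qed.

Lemma chain_subset K S c i j : chain K S c -> i <= j -> j <= K -> S j \subset S i.
Proof.
move=> Sc; elim: j => [|j IHj]; first by rewrite leqn0 => /eqP->.
rewrite leq_eqVlt => /predU1P[->//|le_ij lt_jK].
have [Sj _ _] := Sc j lt_jK; exact: subset_trans Sj (IHj le_ij (ltnW lt_jK)).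
Qed.

Lemma chain_canonical_copy chi S c :
  colorable H chi -> chain (n * chi) S c -> has_canonical_copy.
Proof.
move=> /existsP[f /forallP f_proper] Sc.
have n_gt0 : 0 < n := ltnW H_gt1.
have f_neq u w : adj u w -> f u != f w by move=> uw; apply: (implyP (forallP (f_proper u) w)).
have /card_gt0P[u0 _] := n_gt0.
have chi_gt0 : 0 < chi by apply: leq_ltn_trans (ltn_ord (f u0)).
have lt_iota : n.-1 * chi < size (iota 0 (n * chi)).
  by rewrite size_iota ltn_pmul2r // prednK.
have [t tI t_ok] := pigeonhole_subseq c (iota_uniq 0 _) lt_iota.
have t_uniq : uniq t := subseq_uniq tI (iota_uniq _ _).
have t_lt i : i \in t -> i < n * chi by move/(mem_subseq tI); rewrite mem_iota add0n.
case: t_ok => [[lt_t c_inj]|[lt_t [a ca]]].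
  (* Distinct colours: each vertex gets its own step, and deeper steps are filled first, so weak
     steps suffice. *)
  pose idx (u : H) := nth 0 t (enum_rank u).
  have rk_lt (u : H) : enum_rank u < size t.
    by apply: leq_trans (ltn_ord _) _; rewrite -[X in X <= _](prednK n_gt0).
  have idx_t u : idx u \in t by apply: mem_nth.
  have idx_inj : injective idx.
    move=> u w /eqP; rewrite nth_uniq // => /eqP.
    by move/val_inj/enum_rank_inj.
  have idx_neq u w : u != w -> idx u <= idx w -> idx u < idx w.
    by move=> uw le; rewrite ltn_neqAle le (inj_eq idx_inj) uw.
  have adj_neq u w : adj u w -> u != w by apply: contraTneq => ->; rewrite adj_irrefl.
  have sub u w : u != w -> idx u <= idx w -> S (idx w) \subset S (idx u).+1.
    by move=> uw le; apply: (chain_subset Sc); [apply: idx_neq|apply/ltnW/t_lt].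
  have [||phi [phi_inj _ phiE]] := @greedy_embedding H 'I_N d idx
    (fun u => S (idx u)) (fun u => S (idx u).+1) (fun u => S (idx u).+1)
    (fun u x y => k x y == c (idx u)) deg_le sub.
  - by move=> u w /adj_neq; apply: sub.
  - move=> u W Q WS W_lt QW _ Q_le; have [_ weak _] := Sc _ (t_lt _ (idx_t u)).
    have [x [xS xW xQ]] := weak W Q WS W_lt QW Q_le.
    by exists x; split=> // y yQ; rewrite xQ.
  exists phi; split=> //; apply: Or33; apply: (@lexicographicI _ _ _ _ idx (c \o idx)).
  - by move=> u w /adj_neq; rewrite (inj_eq idx_inj).
  - by move=> u w /= /c_inj e; apply/idx_inj/e.
  - by move=> u w uw lt; apply/eqP/phiE.
(* One colour: each class of [f] gets a step. The shift skips the first occurrence of [a], which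
   need not be strong. *)
pose idx (u : H) := nth 0 t (f u).+1.
have f_lt (u : H) : (f u).+1 < size t by apply: leq_ltn_trans (ltn_ord _) lt_t.
have idx_t u : idx u \in t by apply: mem_nth.
have idx_neq u w : adj u w -> idx u != idx w.
  by move=> uw; rewrite nth_uniq // eqSS; apply: f_neq.
have t0_lt u : nth 0 t 0 < idx u.
  have: sorted ltn t by apply: subseq_sorted tI (iota_ltn_sorted _ _) => //; apply: ltn_trans.
  by move/(sorted_ltn_nth ltn_trans 0); apply; rewrite ?inE //; case: (t) lt_t.
have t0_t : nth 0 t 0 \in t by apply: mem_nth; case: (t) lt_t.
have [|||phi [phi_inj _ phiE]] := @greedy_embedding H 'I_N d idx
  (fun u => S (idx u)) (fun u => S (idx u).+1) (fun=> setT)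
  (fun u x y => k x y == a) deg_le.
- by move=> u w _ _; apply: subsetT.
- move=> u w uw le; apply: (chain_subset Sc); last exact/ltnW/t_lt.
  by rewrite ltn_neqAle idx_neq.
- move=> u W Q _ W_lt _ QS Q_le; have [_ _ strong] := Sc _ (t_lt _ (idx_t u)).
  have := strong _ (t0_lt u); rewrite !ca // => /(_ erefl) /strong_stepP strong_u.
  have [x [xS xW xQ]] := strong_u W Q W_lt QS Q_le.
  by exists x; split=> // y yQ; rewrite xQ.
exists phi; split=> //; apply: Or31; apply: (@monochromaticI _ _ _ _ a) => u w uw.
have := idx_neq u w uw; rewrite neq_ltn => /orP[lt|lt]; first exact/eqP/phiE.
by rewrite setUC; apply/eqP/phiE; rewrite // adj_sym.
Qed.

End UpperBounds.

(** * Lower bounds: colorings without canonical copies *)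

Lemma card_inj_ltn (T : finType) (A : {set T}) (h : T -> nat) m :
  {in A &, injective h} -> {in A, forall x, h x < m} -> #|A| <= m.
Proof.
move=> h_inj h_lt; rewrite cardE -(size_map h) -[leqRHS](size_iota 0).
apply: uniq_leq_size.
  by rewrite map_inj_in_uniq ?enum_uniq // => x y; rewrite !mem_enum; apply: h_inj.
by move=> _ /mapP[x + ->]; rewrite mem_enum mem_iota => /h_lt.
Qed.

(** [h] overwrites the values on [P] arbitrarily; it is injective because the lost values were those
    of [f0]. *)
Lemma card_ffun_agree (A B : finType) (P : {set A}) (f0 : {ffun A -> B}) :
  #|[set f : {ffun A -> B} | [forall x in P, f x == f0 x]]| * #|B| ^ #|P| <= #|B| ^ #|A|.
Proof.
pose h (p : {ffun A -> B} * {ffun {x | x \in P} -> B}) : {ffun A -> B} :=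
  [ffun x => if insub x is Some y then p.2 y else p.1 x].
rewrite -(card_sig (mem P)) -!card_ffun -cardsT -cardsX -(card_in_imset (f := h)).
  exact: max_card.
move=> [f g] [f' g']; rewrite !inE !andbT /= => /forall_inP fP /forall_inP fP' /ffunP hE.
congr (_, _); apply/ffunP => x.
  have [xP|xP] := boolP (x \in P); first by rewrite (eqP (fP x xP)) (eqP (fP' x xP)).
  by have := hE x; rewrite !ffunE insubN.
by have := hE (val x); rewrite !ffunE valK.
Qed.

Lemma not_colorable_edge (H : sgraph) k :
  ~~ colorable H k.+1 -> exists u w : H, adj u w.
Proof.
move=> ncol; have [/existsP[u /existsP[w uw]]|noadj] := boolP [exists u : H, exists w, adj u w].
  by exists u, w.
case/negP: ncol; apply/existsP; exists [ffun=> ord0].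
apply/forallP => u; apply/forallP => w; apply/implyP => uw.
by case/negP: noadj; apply/existsP; exists u; apply/existsP; exists w.
Qed.

Lemma colorable2 (H : sgraph) (side : H -> bool) :
  (forall u w, adj u w -> side u != side w) -> colorable H 2.
Proof.
move=> side_proper; apply/existsP; exists [ffun u => inord (side u)].
apply/forallP => u; apply/forallP => w; apply/implyP => /side_proper.
by rewrite !ffunE -val_eqE /= !inordK //; case: (side u); case: (side w).
Qed.

Lemma colorable2_side (H : sgraph) :
  colorable H 2 -> exists side : H -> bool, forall u w, adj u w -> side u != side w.
Proof.
move=> /existsP[f /forallP f_proper]; exists (fun u => f u == ord0) => u w uw.
have /implyP/(_ uw) := forallP (f_proper u) w.
by rewrite -!val_eqE /=; case: (f u) (f w) => [[|[|?]] ?] [[|[|?]] ?].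
Qed.

Section LowerBounds.

Variables (H : sgraph) (d : nat).
Hypothesis H_reg : regular H d.
Local Notation n := #|H|.

(** Each edge comes from at most two ordered pairs, told apart by the Boolean component of [h]. *)
Lemma card_edges_ge : n * d <= 2 * #|edges H|.
Proof.
pose pairs := [set uw : H * H | (uw.1 \in [set: H]) && (uw.2 \in [set w | adj uw.1 w])].
have <- : #|pairs| = n * d.
  rewrite (card_dep_pairs (mem [set: H]) (fun u => [set w | adj u w])).
  by rewrite (eq_bigr (fun=> d)) ?sum_nat_const ?cardsT // => v _; apply: H_reg.
pose h (uw : H * H) := ([set uw.1; uw.2], enum_rank uw.1 < enum_rank uw.2).
rewrite mulnC -card_bool -[#|{: bool}|]cardsT -cardsX -(card_in_imset (f := h)).
  apply/subset_leq_card/subsetP => _ /imsetP[[u w] + ->].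
  by rewrite !inE /= andbT => uw; apply: mem_edges.
move=> [u w] [u' w']; rewrite !inE /= => uw uw' [eE rE].
have: u \in [set u'; w'] by rewrite -eE !inE eqxx.
have: w \in [set u'; w'] by rewrite -eE !inE eqxx orbT.
rewrite !inE => /orP[] /eqP wE /orP[] /eqP uE; move: uw uw' rE; rewrite {}uE {}wE ?adj_irrefl //.
move=> aw _; have: enum_rank u' != enum_rank w' :> nat.
  rewrite (inj_eq val_inj) (inj_eq enum_rank_inj).
  by apply: contraTneq aw => ->; rewrite adj_irrefl.
by case: ltngtP.
Qed.

Lemma binary_coloring_no_copy m : 2 * m < n -> ~~ colorable H 2 -> ~ canonical_ramsey H (2 ^ m).
Proof.
move=> lt_mn H_ncol.
have [u0 [w0 uw0]] := not_colorable_edge H_ncol.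
have d_gt0 : 0 < d by rewrite -(H_reg u0); apply/card_gt0P; exists w0; rewrite inE.
have cardB : #|{ffun 'I_m -> bool}| = 2 ^ m by rewrite card_ffun card_bool card_ord.
pose g (x : 'I_(2 ^ m)) : {ffun 'I_m -> bool} := enum_val (cast_ord (esym cardB) x).
have g_inj : injective g by move=> x y /enum_val_inj/cast_ord_inj.
pose diff (e : {set 'I_(2 ^ m)}) i := [exists x in e, [exists y in e, g x i != g y i]].
pose col (e : {set 'I_(2 ^ m)}) : nat := if [pick i | diff e i] is Some i then val i else 0.
have colP x y : x != y -> exists2 i : 'I_m, col [set x; y] = i & g x i != g y i.
  move=> xy; rewrite /col; case: pickP => [i /exists_inP[a + /exists_inP[b]]|same].
    rewrite !inE => ha hb ab; exists i => //; move: ab.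
    by case/orP: ha => /eqP->; case/orP: hb => /eqP->; rewrite ?eqxx // eq_sym.
  case/negP: xy; apply/eqP/g_inj/ffunP => i; apply/eqP/negPn/negP => xyi.
  case/negP: (negbT (same i)); apply/exists_inP; exists x; first by rewrite !inE eqxx.
  by apply/exists_inP; exists y; rewrite // !inE eqxx orbT.
move=> /(_ col)[phi [phi_inj]].
have phiP u w : adj u w ->
    exists2 i : 'I_m, col (phi @: [set u; w]) = i & g (phi u) i != g (phi w) i.
  move=> uw; rewrite imset_pair; apply: colP; rewrite (inj_eq phi_inj).
  by apply: contraTneq uw => ->; rewrite adj_irrefl.
have edges_gt : m * d < #|edges H|.
  rewrite -(ltn_pmul2l (isT : 0 < 2)); apply: leq_trans card_edges_ge.
  by rewrite mulnA ltn_pmul2r.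
case=> [mono|rb|[v [c [v_bij c_inj c_col]]]].
- case/negP: H_ncol; have [i0 i0E _] := phiP _ _ uw0.
  apply: (@colorable2 _ (fun u => g (phi u) i0)) => u w uw; have [i iE] := phiP _ _ uw.
  rewrite (_ : i = i0) //; apply: val_inj; rewrite /= -iE -i0E.
  by apply: mono; apply: mem_edges.
- have := card_inj_ltn rb (m := m); rewrite leqNgt => /(_ _)/negP; apply.
    by move=> e /edgesP[u [w [uw ->]]]; have [i -> _] := phiP _ _ uw.
  by apply: leq_ltn_trans edges_gt; rewrite leq_pmulr.
(* [L] holds the positions with a later neighbour. Their colours are distinct and below [m], so
   charging each edge to its earlier endpoint leaves at most [m * d] edges. *)
pose L := [set i : 'I_n | [exists j : 'I_n, (i < j) && adj (v i) (v j)]].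
have L_le : #|L| <= m.
  apply: (@card_inj_ltn _ L c m) => [i j _ _|i]; first exact: c_inj.
  rewrite inE => /existsP[j /andP[ij aij]]; rewrite -(c_col i j ij aij).
  by have [k -> _] := phiP _ _ aij.
pose P := [set p : 'I_n * H | (p.1 \in L) && (p.2 \in [set w | adj (v p.1) w])].
have P_card : #|P| = #|L| * d.
  rewrite (card_dep_pairs (mem L) (fun i => [set w | adj (v i) w])).
  by rewrite (eq_bigr (fun=> d)) ?sum_nat_const // => i _; apply: H_reg.
have : #|edges H| <= #|P|.
  apply: leq_trans (leq_imset_card (fun p : 'I_n * H => [set v p.1; p.2]) _).
  have [v' _ v'K] := v_bij.
  apply/subset_leq_card/subsetP => _ /edgesP[u [w [uw ->]]].
  have: v' u != v' w by apply: contraTneq uw => e; rewrite -[u]v'K e v'K adj_irrefl.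
  rewrite -val_eqE neq_ltn => /orP[lt|lt].
    apply/imsetP; exists (v' u, w); rewrite ?inE /= ?v'K // uw andbT.
    by apply/existsP; exists (v' w); rewrite lt !v'K.
  apply/imsetP; exists (v' w, u); rewrite ?inE /= ?v'K; last by rewrite setUC.
  rewrite adj_sym uw andbT; apply/existsP; exists (v' u).
  by rewrite lt !v'K adj_sym.
rewrite P_card leqNgt => /negP; apply; apply: leq_ltn_trans edges_gt.
by rewrite leq_mul2r L_le orbT.
Qed.

(** There are [n ^ (n * m)] maps and [n ^ n] choices each for the ordering and for the colours. Each
    triple is realised with probability at most [1 / n ^ #|edges H|]. *)
Lemma random_coloring_no_copy m : n * (m + 2) < #|edges H| -> ~ canonical_ramsey H (n ^ m).
Proof.
move=> edges_gt copy; pose N := n ^ m.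
have E_gt0 : 0 < #|edges H| by apply: leq_ltn_trans edges_gt.
have n_gt0 : 0 < n.
  by have /card_gt0P[_ /edgesP[u _]] := E_gt0; apply/card_gt0P; exists u.
pose F := {ffun {set 'I_N} -> 'I_n}.
pose J : finType := ({ffun H -> 'I_N} * {ffun 'I_n -> H} * {ffun 'I_n -> 'I_n})%type.
pose agree (p : J) (f : F) :=
  [forall i : 'I_n, forall j : 'I_n, (i < j) && adj (p.1.2 i) (p.1.2 j) ==>
  (f (p.1.1 @: [set p.1.2 i; p.1.2 j]) == p.2 i)].
pose bad (p : J) (f : F) := [&& injectiveb p.1.1, injectiveb p.1.2 & agree p f].
have cardJ : #|J| = n ^ (n * (m + 2)).
  by rewrite !card_prod !card_ffun !card_ord -expnM -!expnD; congr (_ ^ _); lia.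
have agreeP p f : agree p f -> forall i j : 'I_n, i < j -> adj (p.1.2 i) (p.1.2 j) ->
    f (p.1.1 @: [set p.1.2 i; p.1.2 j]) = p.2 i.
  by move=> /forallP fp i j ij aij; have /forallP/(_ j) := fp i; rewrite ij aij => /eqP.
have bad_le p : #|[set f in F | bad p f]| * n ^ #|edges H| <= #|F|.
  (* Once one bad [f0] exists, every bad [f] agrees with it on the images of all edges. *)
  have [->|/set0Pn[f0]] := eqVneq [set f in F | bad p f] set0; first by rewrite cards0.
  rewrite inE /= => /and3P[/injectiveP phi_inj /injectiveP v_inj /agreeP f0E].
  have [v' _ v'K] : bijective p.1.2 by apply: inj_card_bij; rewrite // card_ord.
  pose P := [set p.1.1 @: (e : {set H}) | e in edges H].
  have cardP : #|P| = #|edges H| by apply: card_imset; apply: imset_inj.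
  rewrite -cardP -[X in X ^ #|P|](card_ord n) card_ffun.
  apply: leq_trans (card_ffun_agree P f0); rewrite leq_mul2r; apply/orP; right.
  apply/subset_leq_card/subsetP => f; rewrite !inE /= => /and3P[_ _ /agreeP fE].
  apply/forall_inP => _ /imsetP[_ /edgesP[u [w [uw ->]]] ->].
  have: v' u != v' w by apply: contraTneq uw => e; rewrite -[u]v'K e v'K adj_irrefl.
  rewrite -val_eqE neq_ltn => /orP[lt|lt].
    by have := fE _ _ lt; have := f0E _ _ lt; rewrite !v'K uw => /(_ isT)-> /(_ isT)->.
  have := fE _ _ lt; have := f0E _ _ lt; rewrite !v'K adj_sym uw setUC.
  by move=> /(_ isT)-> /(_ isT)->.
have F_gt0 : 0 < #|F| by rewrite card_ffun card_ord expn_gt0 n_gt0.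
have : #|[set f in F | [exists p, bad p f]]| < #|F|.
  have nE_gt0 : 0 < n ^ #|edges H| by rewrite expn_gt0 n_gt0.
  rewrite -(ltn_pmul2r nE_gt0); apply: (@leq_ltn_trans (#|J| * #|F|)).
    apply: (@leq_trans (\sum_p #|[set f in F | bad p f]| * n ^ #|edges H|)).
      by rewrite -big_distrl leq_mul2r card_exists_le orbT.
    by rewrite -sum_nat_const; apply: leq_sum => p _; apply: bad_le.
  rewrite mulnC ltn_pmul2l // cardJ ltn_exp2l //.
  have [//|n_le1] := ltnP 1 n.
  have: #|edges H| <= 0; last by rewrite leqNgt E_gt0.
  have /card_gt0P[_ /edgesP[u [w [uw _]]]] := E_gt0.
  by rewrite (fintype_le1P n_le1 w u) adj_irrefl in uw.
move=> lt_bad.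
have [f fN] : exists f : F, ~~ [exists p, bad p f].
  apply/existsP; apply: contraTT lt_bad; rewrite negb_exists -leqNgt => /forallP allB.
  by rewrite -[leqLHS]cardsT; apply/subset_leq_card/subsetP => f _;
  rewrite inE -[X in _ && X]negbK allB.
have {}fN (phi : H -> 'I_N) (v : 'I_n -> H) (c : 'I_n -> 'I_n) : injective phi -> injective v ->
    ~ (forall i j : 'I_n, i < j -> adj (v i) (v j) -> f (phi @: [set v i; v j]) = c i).
  move=> phi_inj v_inj fE; case/negP: fN; apply/existsP.
  exists (finfun phi, finfun v, finfun c); apply/and3P; split.
  - by apply/injectiveP => u w; rewrite !ffunE; apply: phi_inj.
  - by apply/injectiveP => u w; rewrite !ffunE; apply: v_inj.
  apply/forallP => i; apply/forallP => j; apply/implyP => /andP[ij]; rewrite /= !ffunE => aij.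
  by rewrite !imset_pair !ffunE -imset_pair; apply/eqP/fE.
have [phi [phi_inj]] := copy (fun e => val (f e)).
pose v0 (i : 'I_n) : H := enum_val i.
have v0_inj : injective v0 by move=> i j; apply: enum_val_inj.
case=> [mono|rb|[v [c [v_bij c_inj c_col]]]].
- have /card_gt0P[e0 e0E] := E_gt0.
  apply: (fN phi v0 (fun=> f (phi @: e0)) phi_inj v0_inj) => i j _ aij.
  by apply/val_inj/mono => //; apply: mem_edges.
- have := card_inj_ltn rb (m := n); rewrite leqNgt => /(_ _)/negP; apply.
    by move=> e _; apply: ltn_ord.
  by apply: leq_ltn_trans edges_gt; rewrite leq_pmulr // addn2.
(* [insubd] changes [c i] only if it is at least [n], and then position [i] has no later
   neighbour. *)
apply: (fN phi v (fun i => insubd i (c i)) phi_inj (bij_inj v_bij)) => i j ij aij.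
have cE := c_col i j ij aij; apply: val_inj; rewrite /= val_insubd -cE /=.
by rewrite ltn_ord.
Qed.

End LowerBounds.

(** * Chromatic number *)

Lemma leq_chromatic_number (H : sgraph) k : colorable H k -> chromatic_number H <= k.
Proof. by rewrite /chromatic_number; case: ex_minnP => m _ min_m /min_m. Qed.

Lemma colorable_chromatic_number (H : sgraph) : colorable H (chromatic_number H).
Proof. by rewrite /chromatic_number; case: ex_minnP. Qed.

Lemma chromatic_number_le_card (H : sgraph) : chromatic_number H <= #|H|.
Proof.
apply: leq_chromatic_number; apply/existsP; exists [ffun u => enum_rank u].
apply/forallP => u; apply/forallP => w; apply/implyP => uw.
rewrite !ffunE (inj_eq enum_rank_inj).
by apply: contraTneq uw => ->; rewrite adj_irrefl.
Qed.

Lemma chromatic_number_gt1 (H : sgraph) d :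
  regular H d -> 1 < chromatic_number H -> 1 < #|H| /\ 0 < d.
Proof.
move=> H_reg chi_gt1.
have [u [w uw]] : exists u w : H, adj u w.
  apply: (@not_colorable_edge _ 0).
  by apply: contraTN chi_gt1 => /leq_chromatic_number; rewrite -leqNgt.
split; first by apply: leq_trans chi_gt1 (chromatic_number_le_card H).
by rewrite -(H_reg u); apply/card_gt0P; exists w; rewrite inE.
Qed.

(** * Explicit exponents for the upper bounds *)

Section PolynomialBounds.

Variables (H : sgraph) (d : nat).
Hypothesis H_gt1 : 1 < #|H|.
Hypothesis d_gt0 : 0 < d.
Hypothesis deg_le : forall v : H, #|[set w | adj v w]| <= d.
Local Notation n := #|H|.

Let n_gt0 : 0 < n := ltnW H_gt1.

(** The choice [q = n ^ 6] is admissible because [3 < n ^ 2] for [n >= 2]. *)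
Let q_gt : 3 * n ^ 4 < n ^ 6.
Proof.
rewrite (expnD n 4 2) mulnC ltn_pmul2l ?expn_gt0 ?n_gt0 //.
by apply: (@leq_trans (2 ^ 2)); rewrite // leq_exp2r.
Qed.

Lemma canonical_ramsey_bipartite : colorable H 2 -> canonical_ramsey H (n ^ (21 * d)).
Proof.
move=> /colorable2_side[side side_proper] col.
apply: (bipartite_canonical_copy col H_gt1 deg_le d_gt0 side_proper q_gt).
(* The factor 2 is absorbed into [n]; the exponent [1 + (d + 1) + 6 * (d + 2)] is at most [21 * d]
   as [d >= 1]. *)
rewrite -expnM -mulnA -expnD; apply: (@leq_trans (n ^ 1 * n ^ (d.+1 + 6 * d.+2))).
  by rewrite leq_mul2r expn1 H_gt1 orbT.
by rewrite -expnD leq_exp2l //; lia.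
Qed.

Lemma canonical_ramsey_colorable chi :
  0 < chi -> chi <= n -> colorable H chi -> canonical_ramsey H (n ^ (52 * d * chi * n)).
Proof.
move=> chi_gt0 chi_le chi_col col.
have K_gt0 : 0 < n * chi by rewrite muln_gt0 n_gt0.
have Kq : n * chi * n ^ 6 <= n ^ 8.
  by rewrite (expnD n 2 6) leq_mul2r (expnS n 1) expn1 leq_mul2l chi_le !orbT.
have D_le : 2 * (n * chi * n ^ 6) ^ d.+2 <= n ^ (25 * d).
  apply: (@leq_trans (n ^ 1 * (n ^ 8) ^ d.+2)).
    by apply: leq_mul; rewrite ?expn1 // leq_exp2r.
  by rewrite -expnM -expnD leq_exp2l //; lia.
have [|//|[S [c Sc]]] := @chain_or_rainbow H _ d col H_gt1 (n * chi) (n ^ 6) K_gt0 q_gt.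
  apply: (@leq_trans (n ^ d.+1 * n ^ (25 * d) * n ^ (25 * d * (n * chi)))).
    apply: leq_mul; last by rewrite [leqRHS]expnM leq_exp2r.
    by rewrite mulnAC mulnC leq_mul2l D_le orbT.
  by rewrite -!expnD leq_exp2l //; nia.
exact: (chain_canonical_copy H_gt1 deg_le chi_col Sc).
Qed.

End PolynomialBounds.

(** * Bounds on the Erdős-Rado number *)

Lemma canonical_ramsey_monotone (H : sgraph) (M N : nat) :
  M <= N -> canonical_ramsey H M -> canonical_ramsey H N.
Proof.
move=> MN HM col.
have [phi [phi_inj phi_can]] := HM (fun e => col (widen_ord MN @: e)).
have widen_inj : injective (widen_ord MN) by move=> x y [/val_inj].
exists (widen_ord MN \o phi); split; first exact: inj_comp.
have colE (e : {set H}) : col (widen_ord MN @: (phi @: e)) = col ((widen_ord MN \o phi) @: e).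
  by rewrite [in RHS](imset_comp (widen_ord MN)).
case: phi_can => [mono|rb|[v [c [v_bij c_inj c_col]]]].
- by apply: Or31 => e e' eE e'E; rewrite -!colE; apply: mono.
- by apply: Or32 => e e' eE e'E; rewrite -!colE; apply: rb.
by apply: Or33; exists v, c; split=> // i j ij aij; rewrite -colE c_col.
Qed.

Lemma canonical_ramsey_card (H : sgraph) N : canonical_ramsey H N -> #|H| <= N.
Proof.
move=> /(_ (fun=> 0))[phi [phi_inj _]].
by rewrite -[leqRHS]card_ord; apply: leq_card phi_inj.
Qed.

From mathcomp Require Import all_order all_algebra.
From mathcomp Require Import all_classical all_reals all_analysis lra.
Import Order.TTheory GRing.Theory Num.Theory.

Lemma ER_le (H : sgraph) N : canonical_ramsey H N -> (ER H <= N)%N.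
Proof.
move=> HN; rewrite /ER; case: pselect => [ex|//].
by case: ex_minnP => m _; apply; apply/asboolP.
Qed.

Lemma canonical_ramsey_ER (H : sgraph) N : canonical_ramsey H N -> canonical_ramsey H (ER H).
Proof.
move=> HN; rewrite /ER; case: pselect => [ex|[]]; last by exists N; apply/asboolP.
by case: ex_minnP => m /asboolP.
Qed.

(** Monotonicity turns the failure at one [M] into a lower bound; [N] ensures that [ER H] is not the
    default 0. *)
Lemma ER_gt (H : sgraph) M N : canonical_ramsey H N -> ~ canonical_ramsey H M -> (M < ER H)%N.
Proof.
move=> /canonical_ramsey_ER HN; rewrite ltnNge => HM; apply/negP => le_M.
exact/HM/(canonical_ramsey_monotone le_M).
Qed.

Local Open Scope ring_scope.

Theorem theorem1p2 (R : realType) :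
  exists c C : R, [/\ 0 < c, c < C &
    forall (H : sgraph) (n d : nat), #|H| = n -> regular H d ->
      (chromatic_number H = 2%N ->
         n%:R `^ (c * d%:R) <= (ER H)%:R /\
         (ER H)%:R <= n%:R `^ (C * d%:R)) /\
      (forall chi : nat, chi = chromatic_number H -> (3 <= chi)%N ->
         2 `^ (c * n%:R) <= (ER H)%:R /\
         (ER H)%:R <= n%:R `^ (C * d%:R * chi%:R * n%:R))].
Proof.
exists 8^-1, 52; split; [by lra|by lra|] => H n d <- H_reg; split=> [chi2|chi chiE chi_ge3].
  have [H_gt1 d_gt0] : (1 < #|H| /\ 0 < d)%N by apply: chromatic_number_gt1; rewrite ?chi2.
  have H_ge1 : 1 <= #|H|%:R :> R by rewrite ler1n ltnW.
  have HN : canonical_ramsey H (#|H| ^ (21 * d)).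
    apply: canonical_ramsey_bipartite => //; first by move=> v; rewrite H_reg.
    by rewrite -chi2 colorable_chromatic_number.
  split; last first.
    apply: (@le_trans _ _ (#|H|%:R `^ (21 * d)%:R)).
      by rewrite powR_mulrn ?ler0n // -natrX ler_nat ER_le.
    by apply: ler_powR => //; rewrite natrM ler_wpM2r ?ler0n // ler_nat.
  (* For small degrees the trivial bound [#|H| <= ER H] suffices, since the exponent [d / 8] is at
     most 1. *)
  have [d_le|d_gt] := leqP d 8.
    apply: (@le_trans _ _ (#|H|%:R `^ 1)).
      apply: ler_powR => //; have : d%:R <= 8 :> R by rewrite ler_nat.
      by lra.
    by rewrite powRr1 ?ler0n // ler_nat; apply/canonical_ramsey_card/canonical_ramsey_ER/HN.
  apply: (@le_trans _ _ (#|H|%:R `^ (d %/ 4)%:R)).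
    apply: ler_powR => //; have : (d <= 8 * (d %/ 4))%N by lia.
    by rewrite -(ler_nat R) natrM; lra.
  rewrite powR_mulrn ?ler0n // -natrX ler_nat ltnW //; apply: ER_gt HN _.
  apply: random_coloring_no_copy; have := card_edges_ge H_reg.
  have : (#|H| * (2 * (d %/ 4 + 2)) < #|H| * d)%N by rewrite ltn_pmul2l ?(ltnW H_gt1) //; lia.
  by lia.
have [H_gt1 d_gt0] : (1 < #|H| /\ 0 < d)%N.
  by apply: chromatic_number_gt1; rewrite // -chiE ltnW.
have H_ge1 : 1 <= #|H|%:R :> R by rewrite ler1n ltnW.
have chi_le : (chi <= #|H|)%N by rewrite chiE chromatic_number_le_card.
have HN : canonical_ramsey H (#|H| ^ (52 * d * chi * #|H|)).
  apply: canonical_ramsey_colorable => //; first by move=> v; rewrite H_reg.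
  - by rewrite (leq_trans _ chi_ge3).
  - by rewrite chiE colorable_chromatic_number.
split; last first.
  apply: (@le_trans _ _ (#|H|%:R `^ (52 * d * chi * #|H|)%:R)); last by rewrite !natrM.
  by rewrite powR_mulrn ?ler0n // -natrX ler_nat ER_le.
(* The string length [#|H|.-1 %/ 2] is at least [#|H| / 8] because [#|H| >= chi >= 3]. *)
apply: (@le_trans _ _ (2 `^ (#|H|.-1 %/ 2)%:R)).
  apply: ler_powR; first by lra.
  have : (#|H| <= 8 * (#|H|.-1 %/ 2))%N by lia.
  by rewrite -(ler_nat R) natrM; lra.
rewrite powR_mulrn ?ler0n // -natrX ler_nat ltnW //; apply: ER_gt HN _.
apply: (binary_coloring_no_copy H_reg); first by lia.
by apply: contraTN chi_ge3 => /leq_chromatic_number; rewrite -chiE -ltnNge.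
Qed.
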